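(* Let $V$ be a ground set of $n$ elements, $f$ a nonnegative submodular function on $V$, and $w:V\to\mathbb{R}_{\ge0}$ weights. Let $0<b'<b\le 1/2$. Consider the procedure: initialize $w'=w$, $T_1=T_2=\emptyset$; while $w'(V)>(1-b')w(V)$, let $S_i$ be a $\gamma$-approximate solution to the weighted Submodular Sparsest Cut problem on $V$, $f$ with weights $w'$; if $w'(S_i)\le w'(V\setminus S_i)$ set $T_1\leftarrow T_1\cup S_i$ and $w'(v)=0$ for $v\in S_i$; otherwise set $T_2\leftarrow T_2\cup (V\setminus S_i)$ and $w'(v)=0$ for $v\in V\setminus S_i$. At the end, return $T_1$ if $w(T_1)\ge w(T_2)$ and otherwise return $V\setminus T_2$. Here the subroutine's approximation ratio is $\gamma=O(\sqrt{n/\ln n})$. If $(V,f,w)$ contains a $b$-balanced cut of cost $B$, then this procedure finds a $b'/2$-balanced cut $T$ with $f(T)=O\left(\frac{B}{b-b'}\sqrt{\frac{n}{\ln n}}\right)$.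
   Context: $f$ is submodular if $f(S)+f(T)\ge f(S\cup T)+f(S\cap T)$ for all $S,T$. For $S\subseteq V$, $w(S)=\sum_{v\in S}w(v)$. A cut $(S,V\setminus S)$ is $\beta$-balanced if $w(S)\ge \beta\,w(V)$ and $w(V\setminus S)\ge \beta\,w(V)$; its cost is $f(S)$. The weighted Submodular Sparsest Cut problem with weights $w'$ is to find $S$ minimizing $f(S)/(w'(S)\,w'(V\setminus S))$; a $\gamma$-approximate solution has objective at most $\gamma$ times the minimum.
   Formalization: The formal statement assumes w(V) > 0 (with all weights zero the procedure returns the empty set, whose cost may exceed any multiple of B), takes γ ≥ 1, and lets the sparsest cut problem range over cuts with both sides of positive w'-weight. *)

(* Defs.v *)
From HB Require Import structures.
From Stdlib Require Import Relation_Operators.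
From mathcomp Require Import all_boot all_order all_algebra.
From mathcomp Require Import reals exp.
Set Implicit Arguments.
Unset Strict Implicit.
Unset Printing Implicit Defensive.
Import Order.TTheory GRing.Theory Num.Theory.
Local Open Scope ring_scope.

Definition submodular (R : realType) (V : finType) (f : {set V} -> R) : Prop :=
  forall S T : {set V}, f (S :|: T) + f (S :&: T) <= f S + f T.

Definition weight (R : realType) (V : finType) (w : V -> R) (S : {set V}) : R :=
  \sum_(v in S) w v.

Definition balanced (R : realType) (V : finType) (w : V -> R) (beta : R)
    (S : {set V}) : Prop :=
  beta * weight w [set: V] <= weight w S /\
  beta * weight w [set: V] <= weight w (~: S).

Definition sparsity (R : realType) (V : finType) (f : {set V} -> R)
    (w : V -> R) (S : {set V}) : R :=
  f S / (weight w S * weight w (~: S)).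

(* The objective is undefined when a side has weight 0 (in MathComp x / 0 = 0),
   so such cuts are excluded from the minimization. *)
Definition feasible (R : realType) (V : finType) (w : V -> R) (S : {set V}) :
    Prop :=
  0 < weight w S /\ 0 < weight w (~: S).

Definition sparsest_cut (R : realType) (V : finType) (f : {set V} -> R)
    (w : V -> R) (S : {set V}) : Prop :=
  feasible w S /\
  forall S' : {set V}, feasible w S' -> sparsity f w S <= sparsity f w S'.

Definition approx_sparsest_cut (R : realType) (V : finType) (f : {set V} -> R)
    (w : V -> R) (gamma : R) (S : {set V}) : Prop :=
  feasible w S /\
  exists2 Smin : {set V}, sparsest_cut f w Smin &
    sparsity f w S <= gamma * sparsity f w Smin.

Record state (R : realType) (V : finType) := State {
  cur_w : V -> R;
  cur_T1 : {set V};
  cur_T2 : {set V} }.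

Definition zero_on (R : realType) (V : finType) (S : {set V}) (w : V -> R) :
    V -> R :=
  fun v => if v \in S then 0 else w v.

Definition init_state (R : realType) (V : finType) (w : V -> R) : state R V :=
  State w set0 set0.

Definition loop_guard (R : realType) (V : finType) (w : V -> R) (b' : R)
    (st : state R V) : bool :=
  (1 - b') * weight w [set: V] < weight (cur_w st) [set: V].

Definition update (R : realType) (V : finType) (st : state R V) (S : {set V}) :
    state R V :=
  let: State w' T1 T2 := st in
  if weight w' S <= weight w' (~: S)
  then State (zero_on S w') (T1 :|: S) T2
  else State (zero_on (~: S) w') T1 (T2 :|: ~: S).

(* The loop is nondeterministic: each iteration may use any gamma-approximate
   solution. *)
Definition step (R : realType) (V : finType) (f : {set V} -> R) (w : V -> R)
    (b' gamma : R) (st st' : state R V) : Prop :=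
  loop_guard w b' st /\
  exists2 S : {set V},
    approx_sparsest_cut f (cur_w st) gamma S & st' = update st S.

Definition output (R : realType) (V : finType) (w : V -> R) (st : state R V) :
    {set V} :=
  if weight w (cur_T2 st) <= weight w (cur_T1 st) then cur_T1 st
  else ~: cur_T2 st.

(* Total correctness over all choices of approximate solutions: there is no
   infinite run, no run gets stuck inside the loop, and every run that leaves
   the loop returns a set satisfying P. *)
Definition procedure_finds (R : realType) (V : finType) (f : {set V} -> R)
    (w : V -> R) (b' gamma : R) (P : {set V} -> Prop) : Prop :=
  Acc (fun st' st => step f w b' gamma st st') (init_state w) /\
  forall st : state R V,
    clos_refl_trans _ (step f w b' gamma) (init_state w) st ->
    if loop_guard w b' st then exists st', step f w b' gamma st st'
    else P (output w st).

(* Main.v *)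
(** If S* is the b-balanced cut of cost B, then while the guard holds both sides
    of S* keep w'-weight at least a := (b - b') w(V). Hence the approximate
    sparsest cut S_i satisfies f(S_i) <= (2 gamma B / a) r_i, where r_i is the
    w'-weight removed in that iteration. Submodularity and nonnegativity give
    subadditivity under unions and intersections, and the r_i sum to at most
    w(V), so f(T1) and f(V \ T2) are at most 2 gamma B / (b - b'). The removed
    side is never the heavier one, so w' keeps weight at least (1 - b') w(V) / 2,
    which balances the output on the side opposite to T1 (or T2). *)
Require Import Defs.
From Stdlib Require Import Relation_Operators.
From mathcomp Require Import all_boot all_order all_algebra.
From mathcomp Require Import reals exp.
From mathcomp Require Import lra.
Set Implicit Arguments.
Unset Strict Implicit.
Unset Printing Implicit Defensive.
Import Order.TTheory GRing.Theory Num.Theory.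
Local Open Scope ring_scope.

(** * Weights of sets, and the effect of zeroing the weight on a set *)

Section Weight.
Variables (R : realType) (V : finType).
Implicit Types (w : V -> R) (S T : {set V}).

Lemma weight_ge0 w S : (forall v, 0 <= w v) -> 0 <= weight w S.
Proof. by move=> w0; apply: sumr_ge0. Qed.

Lemma weightC w S : weight w S + weight w (~: S) = weight w [set: V].
Proof.
rewrite /weight [RHS](bigID (mem S)) /=; congr (_ + _);
  by apply: eq_bigl => v; rewrite !inE.
Qed.

Lemma weight_subset w S T :
  (forall v, 0 <= w v) -> S \subset T -> weight w S <= weight w T.
Proof.
move=> w0 sST; rewrite /weight [leRHS](big_setID S) /= (setIidPr sST) lerDl.
exact: sumr_ge0.
Qed.

Lemma weightU_le w S T :
  (forall v, 0 <= w v) -> weight w (S :|: T) <= weight w S + weight w T.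
Proof.
move=> w0; rewrite /weight [leLHS](big_setID S) /= setUK lerD2l.
by apply: weight_subset => //; rewrite setDUl setDv set0U subsetDl.
Qed.

Lemma le_weight w1 w2 S :
  (forall v, w1 v <= w2 v) -> weight w1 S <= weight w2 S.
Proof. by move=> le12; apply: ler_sum. Qed.

Lemma weight_gt0_ex w S : 0 < weight w S -> exists2 v, v \in S & w v != 0.
Proof.
move=> wS; apply/exists_inP; apply: contraTT wS => /exists_inPn w0.
rewrite /weight big1 ?ltxx // => v vS; exact/eqP/negbNE/w0.
Qed.

Lemma zero_on_ge0 w S :
  (forall v, 0 <= w v) -> forall v, 0 <= zero_on S w v.
Proof. by move=> w0 v; rewrite /zero_on; case: ifP. Qed.

Lemma zero_on_le w S :
  (forall v, 0 <= w v) -> forall v, zero_on S w v <= w v.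
Proof. by move=> w0 v; rewrite /zero_on; case: ifP. Qed.

Lemma zero_onU w S T : zero_on T (zero_on S w) =1 zero_on (S :|: T) w.
Proof. by move=> v; rewrite /zero_on inE; case: (v \in S); case: (v \in T). Qed.

Lemma weight_zero_on w S : weight (zero_on S w) [set: V] = weight w (~: S).
Proof.
rewrite -(weightC _ S) {1}/weight big1 ?add0r; last first.
  by move=> v vS; rewrite /zero_on vS.
by apply: eq_bigr => v; rewrite /zero_on inE => /negPf->.
Qed.

(** The complement of [S] cannot gain weight, so [S] loses at most what all of [V] loses. *)
Lemma weight_loss w w' S : (forall v, w' v <= w v) ->
  weight w S + weight w' [set: V] <= weight w [set: V] + weight w' S.
Proof.
move=> le_w; rewrite -(weightC w S) -(weightC w' S).
by have := le_weight (~: S) le_w; lra.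
Qed.

End Weight.

(** * Subadditivity and approximate sparsest cuts *)

Section Submodular.
Variables (R : realType) (V : finType) (f : {set V} -> R).
Hypotheses (f_ge0 : forall S, 0 <= f S) (f_sub : submodular f).

Lemma submodularU_le S T : f (S :|: T) <= f S + f T.
Proof. by have := f_sub S T; have := f_ge0 (S :&: T); lra. Qed.

Lemma submodularI_le S T : f (S :&: T) <= f S + f T.
Proof. by have := f_sub S T; have := f_ge0 (S :|: T); lra. Qed.

Lemma sparsity_ge0 w S : feasible w S -> 0 <= sparsity f w S.
Proof. by case=> p q; rewrite divr_ge0 // mulr_ge0 // ltW. Qed.

Lemma sparsest_cut_exists w S :
  feasible w S -> exists T, sparsest_cut f w T.
Proof.
case=> p q.
pose F T := (0 < weight w T) && (0 < weight w (~: T)).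
have FS : F S by rewrite /F p q.
case: (arg_minP (sparsity f w) FS) => T /andP[p' q'] minT.
exists T; split=> // S' [p2 q2]; apply: minT; exact/andP.
Qed.

(** As [gamma >= 1] and sparsity is nonnegative, an exact minimizer qualifies. *)
Lemma approx_sparsest_cut_exists w gamma S :
  1 <= gamma -> feasible w S -> exists T, approx_sparsest_cut f w gamma T.
Proof.
move=> g1 /sparsest_cut_exists[T minT]; have [fT _] := minT.
exists T; split=> //; exists T => //.
by rewrite ler_peMl // sparsity_ge0.
Qed.

Lemma approx_sparsest_cut_le w gamma a S S0 :
  (forall v, 0 <= w v) -> 0 <= gamma -> 0 < a ->
  a <= weight w S0 -> a <= weight w (~: S0) ->
  approx_sparsest_cut f w gamma S ->
  f S <= 2 * gamma * f S0 / a * Num.min (weight w S) (weight w (~: S)).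
Proof.
move=> w0 g0 a0 ap aq [[x0 y0] [Smin [_ minS] leS]].
have p0 := lt_le_trans a0 ap; have q0 := lt_le_trans a0 aq.
have {minS leS} : sparsity f w S <= gamma * sparsity f w S0.
  by apply: (le_trans leS); apply: ler_wpM2l => //; apply: minS.
rewrite /sparsity ler_pdivrMr ?mulr_gt0 //.
have Exy : weight w S + weight w (~: S) = weight w S0 + weight w (~: S0).
  by rewrite !weightC.
move: (weight w S) (weight w (~: S)) (weight w S0) (weight w (~: S0))
  x0 y0 p0 q0 ap aq Exy => x y p q x0 y0 p0 q0 ap aq Exy /le_trans; apply.
have m0 : 0 < Num.min x y by rewrite lt_min x0.
(* [x * y] is min times max, and the max is at most the total [x + y = p + q]. *)
have xyE : x * y <= Num.min x y * (p + q).
  by rewrite -Exy; case: (leP x y) => _; nra.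
(* (p + q) / (p q) = 1 / p + 1 / q <= 2 / a *)
have pqE : (p + q) / (p * q) <= 2 / a.
  rewrite ler_pdivrMr ?mulr_gt0 // mulrAC ler_pdivlMr //; nra.
have -> : gamma * (f S0 / (p * q)) * (x * y) =
          gamma * f S0 * ((x * y) / (p * q)).
  by rewrite (mulrA gamma) -mulrA [_^-1 * _]mulrC.
have -> : 2 * gamma * f S0 / a * Num.min x y =
          gamma * f S0 * (Num.min x y * (2 / a)) by lra.
apply: ler_wpM2l; first by rewrite mulr_ge0.
apply: (@le_trans _ _ (Num.min x y * (p + q) / (p * q))).
  by rewrite ler_pM2r // invr_gt0 mulr_gt0.
by rewrite -mulrA ler_pM2l.
Qed.

End Submodular.

(** * Termination of the loop *)

Lemma step_support (R : realType) (V : finType) (f : {set V} -> R)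
    (w : V -> R) (b' gamma : R) (st st' : state R V) :
  step f w b' gamma st st' ->
  (#|[set v | cur_w st' v != 0%R]| < #|[set v | cur_w st v != 0%R]|)%N.
Proof.
(* Feasibility gives either removed side positive weight, so some element leaves the support of the
   current weights. *)
have zero_on_lt (w' : V -> R) (S : {set V}) : 0 < weight w' S ->
    (#|[set v | zero_on S w' v != 0%R]| < #|[set v | w' v != 0%R]|)%N.
  case/weight_gt0_ex => v vS wv; apply/proper_card/properP; split.
    by apply/subsetP=> u; rewrite !inE /zero_on; case: ifP; rewrite ?eqxx.
  by exists v; rewrite !inE // /zero_on vS eqxx.
case: st => w' T1 T2 [_ [S [[p q] _] ->]] /=.
by case: ifP => _; apply: zero_on_lt.
Qed.

Lemma step_terminates (R : realType) (V : finType) (f : {set V} -> R)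
    (w : V -> R) (b' gamma : R) (st : state R V) :
  Acc (fun st' st => step f w b' gamma st st') st.
Proof.
have [n] := ubnP #|[set v | cur_w st v != 0%R]|.
elim: n st => [|n IHn] st; rewrite ?ltn0 ?ltnS => le_n; first by discriminate.
constructor=> st' /step_support lt_st; exact: IHn (leq_trans lt_st le_n).
Qed.

(** * Loop invariant and quality of the output *)

Section Procedure.
Variables (R : realType) (V : finType) (f : {set V} -> R) (w : V -> R).
Variables (b b' gamma : R) (S0 : {set V}).
Hypotheses (f_ge0 : forall S, 0 <= f S) (f_sub : submodular f).
Hypotheses (w_ge0 : forall v, 0 <= w v) (W_gt0 : 0 < weight w [set: V]).
Hypotheses (b'_gt0 : 0 < b') (b'_lt_b : b' < b) (b_le : b <= 2^-1).
Hypotheses (gamma_ge1 : 1 <= gamma) (S0_bal : balanced w b S0).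

Let W := weight w [set: V].
(** The price per unit of removed weight: the factor in [approx_sparsest_cut_le] at
    [a = (b - b') * W]. *)
Let c := 2 * gamma * f S0 / ((b - b') * W).

(* [f set0] and [f setT] are unconstrained, hence the disjunctions. *)
Definition loop_invariant (st : state R V) : Prop :=
  [/\ cur_w st =1 zero_on (cur_T1 st :|: cur_T2 st) w,
      (1 - b') * W / 2 <= weight (cur_w st) [set: V],
      cur_T1 st = set0 \/ f (cur_T1 st) <= c * (W - weight (cur_w st) [set: V])
    & cur_T2 st = set0 \/
      f (~: cur_T2 st) <= c * (W - weight (cur_w st) [set: V])].

Lemma c_ge0 : 0 <= c.
Proof.
rewrite /c divr_ge0 ?mulr_ge0 //.
- exact: le_trans ler01 gamma_ge1.
- by rewrite subr_ge0 ltW.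
- exact: ltW.
Qed.

Lemma loop_invariant_init : loop_invariant (init_state w).
Proof.
split; [| |by left|by left] => /=; first by move=> v; rewrite /zero_on !inE.
by have := mulr_gt0 b'_gt0 W_gt0; move: W_gt0; rewrite -/W; lra.
Qed.

Lemma loop_invariant_ge0 st : loop_invariant st -> forall v, 0 <= cur_w st v.
Proof. by case=> E _ _ _ v; rewrite E zero_on_ge0. Qed.

Lemma loop_invariant_le st : loop_invariant st -> forall v, cur_w st v <= w v.
Proof. by case=> E _ _ _ v; rewrite E zero_on_le. Qed.

(** Under the guard less than [b' * W] has been removed in total, while each side of [S0] started
    with at least [b * W]. *)
Lemma guard_balanced st : loop_invariant st -> loop_guard w b' st ->
  (b - b') * W <= weight (cur_w st) S0 /\
  (b - b') * W <= weight (cur_w st) (~: S0).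
Proof.
move=> /loop_invariant_le le_w; rewrite /loop_guard -/W => g.
have [] := S0_bal; rewrite -/W.
have := weight_loss S0 le_w; have := weight_loss (~: S0) le_w.
rewrite -/W; split; lra.
Qed.

Lemma loop_progress st : loop_invariant st -> loop_guard w b' st ->
  exists st', step f w b' gamma st st'.
Proof.
move=> I g; have [p q] := guard_balanced I g.
have a0 : 0 < (b - b') * W by rewrite mulr_gt0 // subr_gt0.
have [|S aS] := approx_sparsest_cut_exists f_ge0 gamma_ge1 (w := cur_w st) (S := S0).
  by split; apply: lt_le_trans a0 _.
by exists (update st S); split=> //; exists S.
Qed.

Lemma loop_invariant_step st st' :
  loop_invariant st -> step f w b' gamma st st' -> loop_invariant st'.
Proof.
move=> I [g [S aS ->]]; have [p q] := guard_balanced I g.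
have a0 : 0 < (b - b') * W by rewrite mulr_gt0 // subr_gt0.
have g0 : 0 <= gamma by apply: le_trans ler01 gamma_ge1.
have := approx_sparsest_cut_le f_ge0 (loop_invariant_ge0 I) g0 a0 p q aS.
rewrite -/c; have c0 := c_ge0.
case: st I g aS {p q} => w' T1 T2 [/= E _ H1 H2]; rewrite /loop_guard -/W /=.
move=> g [[x0 y0] _]; have Exy := weightC w' S; rewrite -Exy in H1 H2.
(* For the set left unchanged by the iteration: its bound only loosens as more weight is removed. *)
have grow X r r' : X <= c * (W - (r + r')) -> 0 <= r' -> X <= c * (W - r).
  move=> leX r'0; apply: (le_trans leX); apply: ler_wpM2l => //; lra.
have W'le : weight w' [set: V] <= W.
  by apply: le_weight => v; rewrite E zero_on_le.
case: (leP (weight w' S)) => le_xy fS.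
(* At least half of the current total survives, and the guard puts that total above
   [(1 - b') * W]. *)
- rewrite /loop_invariant /= weight_zero_on; split.
  + by move=> v; rewrite setUAC -zero_onU /zero_on E.
  + lra.
  (* The minimum in [fS] is now the weight being removed, so the new cost adds to the accumulated
     bound. If [T1] is empty, [fS] alone suffices and [f set0] never enters. *)
  + right; case: H1 => [->|H1].
      rewrite set0U; apply: (le_trans fS); apply: ler_wpM2l => //; lra.
    by have := submodularU_le f_ge0 f_sub T1 S; lra.
  + case: H2 => [->|H2]; [by left | right].
    by rewrite (addrC (weight w' S)) in H2; exact: grow H2 (ltW x0).
- rewrite /loop_invariant /= weight_zero_on setCK; split.
  + by move=> v; rewrite setUA -zero_onU /zero_on E.
  + lra.
  + case: H1 => [->|H1]; [by left | right].
    exact: grow H1 (ltW y0).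
  (* Adding [~: S] to [T2] intersects [~: T2] with [S], hence subadditivity under intersection. *)
  + right; rewrite setCU setCK; case: H2 => [->|H2].
      rewrite setC0 setTI; apply: (le_trans fS); apply: ler_wpM2l => //; lra.
    by have := submodularI_le f_ge0 f_sub (~: T2) S; lra.
Qed.

Lemma loop_invariant_reachable st :
  clos_refl_trans _ (step f w b' gamma) (init_state w) st -> loop_invariant st.
Proof.
move=> run; have := loop_invariant_init.
elim: run => // [st1 st2 st12 /loop_invariant_step|st1 st2 st3 _ IH1 _ IH2 /IH1].
  exact.
exact: IH2.
Qed.

Lemma loop_output st : loop_invariant st -> ~~ loop_guard w b' st ->
  balanced w (b' / 2) (output w st) /\
  f (output w st) <= 2 * gamma * (f S0 / (b - b')).
Proof.
case: st => w' T1 T2 [/= E H0 H1 H2].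
rewrite /loop_guard /output /balanced -/W -leNgt /= => ng.
have w'0 v : 0 <= w' v by rewrite E zero_on_ge0.
have W'E : weight w' [set: V] = weight w (~: (T1 :|: T2)).
  by rewrite -weight_zero_on; apply: eq_bigr => v _; apply: E.
have W0 : 0 < W by [].
(* At most [W] is removed overall, and [W] cancels the one in the denominator of [c]. *)
have cW r : 0 <= r -> c * (W - r) <= 2 * gamma * (f S0 / (b - b')).
  move=> r0; have -> : 2 * gamma * (f S0 / (b - b')) = c * W.
    by rewrite /c invfM !mulrA mulfVK // gt_eqF.
  by apply: ler_wpM2l; [exact: c_ge0 | lra].
have W'0 := weight_ge0 [set: V] w'0.
have HU := weightC w (T1 :|: T2).
have leU := weightU_le T1 T2 w_ge0.
have C1 : weight w (~: (T1 :|: T2)) <= weight w (~: T1).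
  by apply: weight_subset => //; rewrite setCS subsetUl.
have C2 : weight w (~: (T1 :|: T2)) <= weight w (~: T2).
  by apply: weight_subset => //; rewrite setCS subsetUr.
have b'W : 0 < b' * W by rewrite mulr_gt0.
have bW : b' * W <= (1 - b') * W.
  by rewrite ler_pM2r //; move: b'_lt_b b_le; lra.
(* The failed guard gives [T1 :|: T2] weight at least [b' * W], so the heavier set has half of that;
   its complement contains the surviving weight, at least [(1 - b') * W / 2], which suffices since
   [b' <= 1 - b']. Positive weight also rules out the empty-set disjunct of the invariant. *)
rewrite -/W in HU; case: ifPn => [le21|]; last rewrite -ltNge => lt12.
- split; first by split; lra.
  case: H1 => [T10|/le_trans]; last by apply; apply: cW.
  have : weight w T1 = 0 by rewrite T10 /weight big_set0.
  by lra.
- rewrite setCK; split; first by split; lra.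
  case: H2 => [T20|/le_trans]; last by apply; apply: cW.
  have : weight w T2 = 0 by rewrite T20 /weight big_set0.
  by have := weight_ge0 T1 w_ge0; lra.
Qed.

End Procedure.

Theorem theorem11 (R : realType) (C : R) :
  exists K : R,
    forall (V : finType) (f : {set V} -> R) (w : V -> R) (b b' gamma B : R),
      (forall S : {set V}, 0 <= f S) ->
      submodular f ->
      (forall v : V, 0 <= w v) ->
      0 < weight w [set: V] ->
      0 < b' -> b' < b -> b <= 2^-1 ->
      1 <= gamma ->
      gamma <= C * Num.sqrt (#|V|%:R / ln #|V|%:R) ->
      (exists2 S : {set V}, balanced w b S & f S = B) ->
      procedure_finds f w b' gamma (fun T : {set V} =>
        balanced w (b' / 2) T /\
        f T <= K * (B / (b - b') * Num.sqrt (#|V|%:R / ln #|V|%:R))).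
Proof.
(* The 2 comes from [loop_output], and [C] from the bound on [gamma]. *)
exists (2 * C) => V f w b b' gamma B f0 fs w0 W0 b'0 b'b b2 g1 gC [S0 bal <-].
split=> [|st /loop_invariant_reachable I]; first exact: step_terminates.
have {}I := I b S0 f0 fs w0 W0 b'0 b'b g1 bal.
case: ifPn => [|ng]; first exact: loop_progress I.
have [balT leT] := loop_output f0 w0 W0 b'0 b'b b2 g1 I ng.
split=> //; apply: (le_trans leT).
have D0 : 0 <= f S0 / (b - b') by rewrite divr_ge0 // subr_ge0 ltW.
by have := ler_wpM2r D0 gC; lra.
Qed.
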